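(* Let $k\ge 1$, let $b_0,\ldots,b_k\in\mathbb{C}$ and let $\{\alpha_n\}_{n\ge 0}$ be a sequence in $\mathbb{C}$. The linear non-homogeneous difference equation of order $k+1$ with constant coefficients $$x_{n+1}+b_0x_n+b_1x_{n-1}+\cdots+b_kx_{n-k}=\alpha_n$$ has the full triangular factorization (FTF) property and is equivalent to the following triangular system of $k+1$ first order linear non-homogeneous equations $$\begin{aligned} z_{0,n+1}&=\alpha_n+c_0z_{0,n},\\ z_{1,n+1}&=z_{0,n+1}+c_1z_{1,n},\\ &\ \ \vdots\\ z_{k,n+1}&=z_{k-1,n+1}+c_kz_{k,n},\end{aligned}$$ in which $z_{k,n}=x_n$ is the solution of the original equation and the constants $c_0,c_1,\ldots,c_k$ are the eigenvalues of the homogeneous part of the equation, i.e., the roots of the characteristic polynomial $$P(z)=z^{k+1}+b_0z^k+b_1z^{k-1}+\cdots+b_{k-1}z+b_k.$$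
   Context: The roots $c_0,\ldots,c_k$ of $P$ are listed with multiplicity. A solution of the difference equation is a sequence $\{x_n\}_{n\ge -k}$ in $\mathbb{C}$ satisfying it for all $n\ge 0$. A difference equation of order $k+1$ has the full triangular factorization (FTF) property if it can be factored completely into (i.e., is equivalent to) a triangular system of $k+1$ first order difference equations, where triangular means that each equation is independent of the variables of the equations listed below it. Equivalence of the equation with the displayed system means: a sequence $\{x_n\}_{n\ge -k}$ in $\mathbb{C}$ is a solution of the difference equation if and only if there are sequences $\{z_{j,n}\}_{n\ge -j}$ in $\mathbb{C}$, $j=0,1,\ldots,k$, with $z_{k,n}=x_n$ for all $n\ge -k$, such that $z_{0,n+1}=\alpha_n+c_0z_{0,n}$ for all $n\ge 0$ and, for each $j=1,\ldots,k$, $z_{j,n+1}=z_{j-1,n+1}+c_jz_{j,n}$ for all $n\ge -j$. *)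

(* Defs.v *)
From HB Require Import structures.
From mathcomp Require Import all_boot all_order all_algebra.
From mathcomp Require Import reals complex.

Set Implicit Arguments.
Unset Strict Implicit.
Unset Printing Implicit Defensive.

Import Order.TTheory GRing.Theory Num.Theory.
Local Open Scope ring_scope.

(* A sequence {x_n}_{n >= -k} is represented by a function on int; every
   predicate below reads it only at indices n >= -k, so the remaining values
   are irrelevant.  Similarly z j stands for {z_{j,n}}_{n >= -j}.  A
   difference equation of order k+1 is identified with the predicate "x is a
   solution". *)

Definition lin_solution (R : realType) (k : nat) (b : 'I_k.+1 -> R[i])
    (alpha : nat -> R[i]) (x : int -> R[i]) : Prop :=
  forall n : nat,
    x (n%:Z + 1) + \sum_(i < k.+1) b i * x (n%:Z - i%:Z) = alpha n.

Definition lin_char_poly (R : realType) (k : nat) (b : 'I_k.+1 -> R[i]) :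
    {poly R[i]} :=
  'X^(k.+1) + \sum_(i < k.+1) b i *: 'X^(k - i).

(* The family c lists the roots of p, each one as often as its multiplicity
   (which is 0 for a non-root). *)
Definition roots_with_mult (R : realType) (m : nat) (c : 'I_m -> R[i])
    (p : {poly R[i]}) : Prop :=
  forall a : R[i], #|[set i | c i == a]| = mup a p.

Definition equiv_system (R : realType) (k : nat)
    (E : (int -> R[i]) -> Prop) (S : ('I_k.+1 -> int -> R[i]) -> Prop) : Prop :=
  forall x : int -> R[i],
    E x <-> exists z : 'I_k.+1 -> int -> R[i],
      (forall n : int, - k%:Z <= n -> z ord_max n = x n) /\ S z.

(* A system of first order equations: the j-th one, which holds for all
   n >= -j, gives z_{j,n+1} as phi j n u v, where u i = z_{i,n+1} and
   v i = z_{i,n}. *)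
Definition first_order_system (R : realType) (k : nat)
    (phi : 'I_k.+1 -> int -> ('I_k.+1 -> R[i]) -> ('I_k.+1 -> R[i]) -> R[i])
    (z : 'I_k.+1 -> int -> R[i]) : Prop :=
  forall (j : 'I_k.+1) (n : int), - j%:Z <= n ->
    z j (n + 1) = phi j n (fun i => z i (n + 1)) (fun i => z i n).

(* The right-hand side for z_{j,n+1} may involve z_{j,n} and the variables
   z_{i,n}, z_{i,n+1} of the equations i < j listed above it, but no variable
   of an equation i > j.  The conditions - i <= n + 1 and - i <= n forbid
   reading z_i at indices where the sequence {z_{i,n}}_{n >= -i} has no term. *)
Definition triangular (R : realType) (k : nat)
    (phi : 'I_k.+1 -> int -> ('I_k.+1 -> R[i]) -> ('I_k.+1 -> R[i]) -> R[i]) :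
    Prop :=
  forall (j : 'I_k.+1) (n : int) (u u' v v' : 'I_k.+1 -> R[i]),
    - j%:Z <= n ->
    (forall i : 'I_k.+1, (i < j)%N -> - i%:Z <= n + 1 -> u i = u' i) ->
    (forall i : 'I_k.+1, (i <= j)%N -> - i%:Z <= n -> v i = v' i) ->
    phi j n u v = phi j n u' v'.

(* The full triangular factorization property of an equation of order k+1. *)
Definition FTF (R : realType) (k : nat) (E : (int -> R[i]) -> Prop) : Prop :=
  exists phi : 'I_k.+1 -> int ->
      ('I_k.+1 -> R[i]) -> ('I_k.+1 -> R[i]) -> R[i],
    triangular phi /\ equiv_system E (first_order_system phi).

Definition lin_triangular_system (R : realType) (k : nat)
    (alpha : nat -> R[i]) (c : 'I_k.+1 -> R[i])
    (z : 'I_k.+1 -> int -> R[i]) : Prop :=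
  (forall n : nat, z ord0 (n%:Z + 1) = alpha n + c ord0 * z ord0 n%:Z) /\
  (forall i j : 'I_k.+1, j = i.+1 :> nat -> forall n : int, - j%:Z <= n ->
     z j (n + 1) = z i (n + 1) + c j * z j n).

(* Main.v *)
Require Import Defs.
From HB Require Import structures.
From mathcomp Require Import all_boot all_order all_algebra.
From mathcomp Require Import reals complex.
From mathcomp Require Import zify.

Set Implicit Arguments.
Unset Strict Implicit.
Unset Printing Implicit Defensive.

Import Order.TTheory GRing.Theory Num.Theory.
Local Open Scope ring_scope.

(** A polynomial [p] acts on two-sided sequences by substituting the shift
    [(E x) n = x (n + 1)] for the variable, and the difference equation reads
    [(P(E) x) (n - k) = alpha n], where [P] is the characteristic polynomial.
    The field being algebraically closed, [P] is the product of the
    [E - c_i]; peeling off one linear factor at a time lowers the order by one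
    at each step, and the intermediate sequences are the variables of the
    triangular system: up to a translation of the index, [z_j] is the product
    of the [E - c_i] with [i > j], applied to [x] ([partial_factor]).

    For a solution [x] these sequences satisfy the system, because
    [z_(j-1),n+1 = z_j,n+1 - c_j z_j,n] is the composition of one more factor
    ([partial_factorS]) and the equation for [z_0] is the original one
    ([partial_factor0]).  Conversely, [z_k = x] determines a solution of the
    system: its equations give [z_(j-1)] in terms of [z_j], so that downwards
    from [j = k] every [z_j] is the sequence above, and the equation for [z_0]
    becomes the equation for [x] ([lin_equiv_triangular]).  The index ranges
    match, since [n >= -j] exactly when [n + 1 >= -(j-1)].

    The full triangular factorization property follows because the
    characteristic polynomial does have [k+1] roots, and the displayed system
    is a triangular system of first order equations ([first_order_lin_rhs]). *)

(** * Polynomials in the shift operator *)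

Section ShiftAction.

Variable F : comNzRingType.
Implicit Types (p q : {poly F}) (x : int -> F) (n : int).

Definition shift_act p x n : F := \sum_(i < size p) p`_i * x (n + i%:Z).

(** Summing over a common range longer than both polynomials makes the action
    visibly linear in the polynomial. *)
Lemma shift_act_wide m p x n : (size p <= m)%N ->
  shift_act p x n = \sum_(i < m) p`_i * x (n + i%:Z).
Proof.
move=> le_pm.
rewrite /shift_act (big_ord_widen m (fun i => p`_i * x (n + i%:Z)) le_pm).
rewrite big_mkcond; apply: eq_bigr => i _; case: ltnP => // le_pi.
by rewrite nth_default ?mul0r.
Qed.

Lemma shift_act0 x n : shift_act 0 x n = 0.
Proof. by rewrite /shift_act size_poly0 big_ord0. Qed.

Lemma shift_actD p q x n :
  shift_act (p + q) x n = shift_act p x n + shift_act q x n.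
Proof.
pose m := maxn (size p) (size q).
rewrite !(@shift_act_wide m) ?leq_maxl ?leq_maxr ?size_polyD //.
by rewrite -big_split; apply: eq_bigr => i _; rewrite coefD mulrDl.
Qed.

Lemma shift_actZ a p x n : shift_act (a *: p) x n = a * shift_act p x n.
Proof.
rewrite !(@shift_act_wide (size p)) ?size_scale_leq // big_distrr.
by apply: eq_bigr => i _; rewrite coefZ /= mulrA.
Qed.

Lemma shift_act_sum (I : finType) (f : I -> {poly F}) x n :
  shift_act (\sum_i f i) x n = \sum_i shift_act (f i) x n.
Proof.
apply: (big_morph (fun p => shift_act p x n)) => [p q|].
  exact: shift_actD.
exact: shift_act0.
Qed.

Lemma shift_actMX p x n : shift_act ('X * p) x n = shift_act p x (n + 1).
Proof.
have size_le : (size ('X * p)%R <= (size p).+1)%N.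
  by rewrite (leq_trans (size_polyMleq _ _)) // size_polyX.
rewrite (shift_act_wide _ _ size_le) big_ord_recl coefXM mul0r add0r.
by apply: eq_bigr => i _; rewrite coefXM /= -addrA.
Qed.

Lemma shift_act1 x n : shift_act 1 x n = x n.
Proof. by rewrite /shift_act size_poly1 big_ord1 coef1 mul1r addr0. Qed.

Lemma shift_actXn m x n : shift_act 'X^m x n = x (n + m%:Z).
Proof.
elim: m n => [|m IHm] n; first by rewrite expr0 shift_act1 addr0.
by rewrite exprS shift_actMX IHm -addrA.
Qed.

Lemma shift_act_XsubCM a p x n :
  shift_act (('X - a%:P) * p) x n
  = shift_act p x (n + 1) - a * shift_act p x n.
Proof.
by rewrite mulrBl mul_polyC -scaleNr shift_actD shift_actMX shift_actZ mulNr.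
Qed.

(** * Removing the linear factors one at a time *)

Variables (k : nat) (c : 'I_k.+1 -> F).

Definition tail_prod (j : nat) : {poly F} :=
  \prod_(i < k.+1 | (j < i)%N) ('X - (c i)%:P).

(** The translation by [k - j], the degree of the product, makes the value at
    [n] depend on [x (n - (k - j)), .., x n] only. *)
Definition partial_factor x (j : nat) (n : int) : F :=
  shift_act (tail_prod j) x (n + j%:Z - k%:Z).

Lemma tail_prodS (i j : 'I_k.+1) : j = i.+1 :> nat ->
  tail_prod i = ('X - (c j)%:P) * tail_prod j.
Proof.
move=> ji; rewrite /tail_prod (bigD1 j) /=; last by rewrite ji.
congr (_ * _); apply: eq_bigl => l.
by rewrite -(inj_eq val_inj) /=; lia.
Qed.

Lemma tail_prod0 :
  \prod_i ('X - (c i)%:P) = ('X - (c ord0)%:P) * tail_prod 0.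
Proof.
rewrite (bigD1 ord0) //=; congr (_ * _); apply: eq_bigl => l.
by rewrite -(inj_eq val_inj) /=; lia.
Qed.

Lemma partial_factor_max x n : partial_factor x k n = x n.
Proof.
rewrite /partial_factor addrK /tail_prod big_pred0 ?shift_act1 // => i.
by have := ltn_ord i; lia.
Qed.

Lemma partial_factorS x (i j : 'I_k.+1) n : j = i.+1 :> nat ->
  partial_factor x i (n + 1)
  = partial_factor x j (n + 1) - c j * partial_factor x j n.
Proof.
move=> ji; rewrite /partial_factor (tail_prodS ji) shift_act_XsubCM.
by congr (shift_act _ _ _ - _ * shift_act _ _ _); rewrite ji; lia.
Qed.

Lemma partial_factor0 x n :
  partial_factor x 0 (n + 1) - c ord0 * partial_factor x 0 n
  = shift_act (\prod_i ('X - (c i)%:P)) x (n - k%:Z).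
Proof.
rewrite tail_prod0 shift_act_XsubCM /partial_factor.
by congr (shift_act _ _ _ - _ * shift_act _ _ _); lia.
Qed.

End ShiftAction.

(** * Equivalence with the triangular system *)

Section LinearEquation.

Variables (R : realType) (k : nat) (b : 'I_k.+1 -> R[i]) (alpha : nat -> R[i]).

Lemma shift_act_char_poly (x : int -> R[i]) (n : int) :
  shift_act (lin_char_poly b) x (n - k%:Z)
  = x (n + 1) + \sum_(i < k.+1) b i * x (n - i%:Z).
Proof.
rewrite /lin_char_poly shift_actD shift_actXn shift_act_sum.
congr (x _ + _); first by lia.
apply: eq_bigr => i _; rewrite shift_actZ shift_actXn.
by congr (_ * x _); have := ltn_ord i; lia.
Qed.

(** The hypothesis on [c] is a factorization because roots given by their
    multiplicities and roots supplied by algebraic closure both lead to one.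
    The solution is recovered by induction on the distance [d] from [j] to the
    last variable, which is the one that [x] prescribes. *)
Lemma lin_equiv_triangular (c : 'I_k.+1 -> R[i]) :
  lin_char_poly b = \prod_i ('X - (c i)%:P) ->
  equiv_system (lin_solution b alpha) (lin_triangular_system alpha c).
Proof.
move=> charE x; split=> [sol | [z [zx [z0E zE]]]].
  exists (fun j => partial_factor c x j); split=> [n _|].
    by rewrite partial_factor_max.
  split=> [n | i j ji n _]; last by rewrite (partial_factorS _ _ _ ji) subrK.
  apply/eqP; rewrite -subr_eq partial_factor0 -charE shift_act_char_poly.
  exact/eqP/sol.
have zP d (j : 'I_k.+1) (n : int) : (j + d)%N = k -> - j%:Z <= n ->
    z j n = partial_factor c x j n.
  elim: d j n => [|d IHd] j n jd le_jn.
    have jk : j = k :> nat by rewrite addn0 in jd.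
    rewrite jk in le_jn *; rewrite partial_factor_max -zx //.
    by congr (z _ _); apply: val_inj.
  have lt_jk : (j.+1 < k.+1)%N by lia.
  pose j' := Ordinal lt_jk.
  have j'd : (j' + d)%N = k by rewrite /= addSnnS.
  (* The equation for [z j'] at [n - 1] expresses [z j n]. *)
  have le_j'n : - j'%:Z <= n - 1 by move: le_jn; rewrite /=; lia.
  have := @partial_factorS _ _ c x j j' (n - 1) erefl.
  have := zE j j' erefl (n - 1) le_j'n.
  rewrite subrK !(IHd j' _ j'd) ?(le_trans le_j'n) ?gerBl // => zj' ->.
  by rewrite zj' addrK.
move=> n; rewrite -shift_act_char_poly charE -partial_factor0.
have z0 (m : int) : 0 <= m -> z ord0 m = partial_factor c x 0 m.
  by move=> ?; apply: (zP k ord0).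
by rewrite -!z0 // z0E addrK.
Qed.

(** * Roots of the characteristic polynomial *)

Lemma size_lin_char_tail :
  (size (\sum_(i < k.+1) b i *: 'X^(k - i))%R
   < size ('X^(k.+1) : {poly R[i]})%R)%N.
Proof.
rewrite size_polyXn ltnS; apply: (leq_trans (size_sum _ _ _)).
apply/bigmax_leqP => i _; apply: (leq_trans (size_scale_leq _ _)).
by rewrite size_polyXn ltnS leq_subr.
Qed.

Lemma lin_char_poly_factor :
  {r : seq R[i] | size r = k.+1 & lin_char_poly b = \prod_(a <- r) ('X - a%:P)}.
Proof.
have [r] := closed_field_poly_normal (lin_char_poly b).
have -> : lead_coef (lin_char_poly b) = 1.
  by rewrite /lin_char_poly lead_coefDl ?size_lin_char_tail ?lead_coefXn.
rewrite scale1r => charE; exists r => //.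
apply: succn_inj; rewrite -(size_prod_XsubC r id) -charE.
by rewrite /lin_char_poly size_polyDl ?size_lin_char_tail ?size_polyXn.
Qed.

(** Prescribing all multiplicities determines the multiset of roots, hence the
    product of the linear factors. *)
Lemma prod_roots_with_mult (c : 'I_k.+1 -> R[i]) :
  roots_with_mult c (lin_char_poly b) ->
  lin_char_poly b = \prod_i ('X - (c i)%:P).
Proof.
have [r _ charE] := lin_char_poly_factor => multc.
have perm_rc : perm_eq r (codom c).
  apply/allP => a _; apply/eqP => /=.
  rewrite -(mu_prod_XsubC a r) -charE -multc cardsE.
  by rewrite /codom /image_mem count_map cardE enumT -size_filter.
by rewrite charE (perm_big _ perm_rc) /codom /image_mem big_map big_enum.
Qed.

(** * The displayed system as a triangular first order system *)

Definition lin_rhs (c : 'I_k.+1 -> R[i]) (j : 'I_k.+1) (n : int)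
    (u v : 'I_k.+1 -> R[i]) : R[i] :=
  (if j == 0%N :> nat then alpha `|n|%N else u (inord j.-1)) + c j * v j.

Lemma triangular_lin_rhs c : triangular (lin_rhs c).
Proof.
move=> j n u u' v v' le_jn eq_u eq_v; rewrite /lin_rhs eq_v //.
congr (_ + _); case: eqP => // j_neq0; have := ltn_ord j => lt_jk.
by apply: eq_u; rewrite inordK; lia.
Qed.

Lemma first_order_lin_rhs c z :
  first_order_system (lin_rhs c) z <-> lin_triangular_system alpha c z.
Proof.
split=> [zE | [z0E zE] j n le_jn].
  split=> [n | i j ji n le_jn]; first by rewrite (zE ord0).
  by rewrite (zE j) // /lin_rhs ji /= inord_val.
rewrite /lin_rhs; case: eqP => [j0 | j_neq0].
  have -> : j = ord0 by apply: val_inj.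
  move: le_jn; rewrite j0 oppr0 => n_ge0.
  by rewrite -[in LHS](gez0_abs n_ge0) -[in X in _ = _ + _ * X](gez0_abs n_ge0).
apply: zE => //; rewrite inordK; have := ltn_ord j; lia.
Qed.

End LinearEquation.

Theorem corollary1 (R : realType) (k : nat) (hk : (1 <= k)%N)
    (b : 'I_k.+1 -> R[i]) (alpha : nat -> R[i]) :
  FTF k (lin_solution b alpha) /\
  (forall c : 'I_k.+1 -> R[i], roots_with_mult c (lin_char_poly b) ->
     equiv_system (lin_solution b alpha) (lin_triangular_system alpha c)).
Proof.
split=> [|c multc]; last exact/lin_equiv_triangular/prod_roots_with_mult.
have [r sz_r charE] := lin_char_poly_factor b.
pose c (i : 'I_k.+1) := r`_i.
have prodE : lin_char_poly b = \prod_i ('X - (c i)%:P).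
  by rewrite charE (big_nth 0) sz_r big_mkord.
exists (lin_rhs alpha c); split=> [|x]; first exact: triangular_lin_rhs.
rewrite (lin_equiv_triangular alpha prodE x).
by split=> -[z [zx sys]]; exists z; split=> //; apply/first_order_lin_rhs.
Qed.
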